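(* There is an absolute constant $c>0$ such that the following holds. Let $\mathcal{A}$ be a local $(1,\tfrac14)$-Lipschitz filter over the hypercube $\{0,1\}^d$ for functions with range $[0,r]$. Then for all even integers $r\ge4$ and all integers $d\ge 2^{16}r$, there exists a function $f:\{0,1\}^d\to[0,r]$ such that the worst-case (over queries and random seeds) number of lookups that $\mathcal{A}$ makes on input $f$ is at least $(d/r)^{c r}$.
   Context: The hypercube $\{0,1\}^d$ is the graph where two points are adjacent iff they differ in exactly one coordinate; its distance is the Hamming distance $|x-y|$. A function $g$ is Lipschitz if $|g(x)-g(y)|\le|x-y|$ for all $x,y$. A local $(1,\tfrac14)$-Lipschitz filter is a randomized algorithm $\mathcal{A}(x,\rho)$ that gets lookup (oracle) access to $f:\{0,1\}^d\to[0,r]$, a query $x\in\{0,1\}^d$ and a random seed $\rho$, such that with probability at least $3/4$ over $\rho$, the map $x\mapsto\mathcal{A}(x,\rho)$ is a Lipschitz function $g_\rho$, and moreover $g_\rho=f$ whenever $f$ is Lipschitz. A lookup is an oracle call to $f$. *)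

(* Defs.v *)
From HB Require Import structures.
From mathcomp Require Import all_boot all_order all_algebra.
From mathcomp Require Import boolp classical_sets reals ereal measure probability.
From mathcomp Require Import Rstruct.
Set Implicit Arguments. Unset Strict Implicit. Unset Printing Implicit Defensive.
Import Order.TTheory GRing.Theory Num.Theory.
Local Open Scope ring_scope.

Definition R := Rdefinitions.R.

Definition cube (d : nat) := {ffun 'I_d -> bool}.

Definition hamming (d : nat) (x y : cube d) : nat := #|[set i | x i != y i]|.

Definition lipschitz (d : nat) (g : cube d -> R) : Prop :=
  forall x y : cube d, `|g x - g y| <= (hamming x y)%:R.

Definition ranged (d : nat) (r : R) (f : cube d -> R) : Prop :=
  forall x, 0 <= f x <= r.

(* An adaptive oracle algorithm (for fixed query point and seed): a finite
   query tree; at an [Ask q k] node it looks up f q and continues with k (f q). *)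
Inductive qtree (Q : Type) : Type :=
| Out of R
| Ask of Q & (R -> qtree Q).
Arguments Out {Q}.
Arguments Ask {Q}.

Fixpoint run (Q : Type) (f : Q -> R) (t : qtree Q) : R :=
  match t with Out v => v | Ask q k => run f (k (f q)) end.

Fixpoint lookups (Q : Type) (f : Q -> R) (t : qtree Q) : nat :=
  match t with Out _ => 0%N | Ask q k => (lookups f (k (f q))).+1 end.

(* A : query x -> seed rho -> oracle algorithm; seeds drawn from probability P.
   Local (1,1/4)-Lipschitz filter for functions with range [0,r]:
   for every f with range [0,r], with probability >= 3/4 over rho
   (i.e. on some measurable event of probability >= 3/4), x |-> A^f(x,rho)
   is Lipschitz, and equals f whenever f is Lipschitz. *)
Definition local_lipschitz_filter (d : nat) (r : R)
  (dm : measure_display) (Omega : measurableType dm) (P : probability Omega R)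
  (A : cube d -> Omega -> qtree (cube d)) : Prop :=
  forall f : cube d -> R, ranged r f ->
    exists S : set Omega,
      [/\ measurable S, ((3 / 4)%:E <= P S)%E &
          forall rho, S rho ->
            lipschitz (fun x => run f (A x rho)) /\
            (lipschitz f -> (fun x => run f (A x rho)) = f)].

(* Main.v *)
Require Import Defs.
From HB Require Import structures.
From mathcomp Require Import all_boot all_order all_algebra.
From mathcomp Require Import boolp classical_sets reals ereal measure probability.
From mathcomp Require Import Rstruct.
From mathcomp Require Import exp.
From mathcomp Require Import numfun lebesgue_integral measurable_realfun.
From mathcomp Require Import zify ring lra.
Import Order.TTheory GRing.Theory Num.Theory.
Local Open Scope ring_scope.

(** Write [r = 2h] and take random points [x], [y] at distance [n = r - 1].
    The valley [min(|z - x|, h)] and the peak [r - min(|z - y|, h)] are Lipschitz,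
    so a good seed returns them unchanged.  Gluing the peak, inside the ball of
    radius [h] around [y], to the valley elsewhere gives a function with a
    non-Lipschitz pair of values [0] at [x] and [r] at [y]; a good seed must
    repair it, so its run on query [x] with oracle the valley meets the ball
    around [y], or its run on query [y] with oracle the peak meets the ball
    around [x].  For a fixed lookup this happens for a fraction at most
    [(8 r / d)^h] of the choices of the other centre, while some seed is good for
    a quarter of all pairs; hence [8 L (8 r / d)^h >= 1] if [L] bounds the number
    of lookups. *)

(** * Runs of query trees and the points they look up *)

Fixpoint visited (Q : Type) (f : Q -> R) (t : qtree Q) : seq Q :=
  if t is Ask q k then q :: visited Q f (k (f q)) else [::].
Arguments visited {Q}.

Lemma size_visited (Q : Type) (f : Q -> R) (t : qtree Q) :
  size (visited f t) = lookups f t.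
Proof. by elim: t => //= q k IH; rewrite IH. Qed.

Lemma eq_run (Q : eqType) (f g : Q -> R) (t : qtree Q) :
  {in visited f t, f =1 g} -> run f t = run g t.
Proof.
elim: t => //= q k IH fg.
rewrite -(fg q (mem_head _ _)); apply: IH => z z_in.
by apply: fg; rewrite inE z_in orbT.
Qed.

(** * Counting points on Hamming spheres *)

(** For fixed [x] this encodes [y] as a set of coordinates, so that the sphere of radius [n] around
    [x] becomes the family of [n]-subsets. *)
Definition diffset (d : nat) (x y : cube d) : {set 'I_d} := [set i | x i != y i].

Lemma diffset_inj (d : nat) (x : cube d) : injective (diffset d x).
Proof.
move=> y y' /finset.setP eqD; apply/ffunP => i.
by have := eqD i; rewrite !inE; case: (x i); case: (y i); case: (y' i).
Qed.

Lemma hammingC (d : nat) (x y : cube d) : hamming x y = hamming y x.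
Proof. by apply: eq_card => i; rewrite !inE eq_sym. Qed.

Lemma hammingxx (d : nat) (x : cube d) : hamming x x = 0%N.
Proof. by apply: eq_card0 => i; rewrite !inE eqxx. Qed.

Lemma hamming_triangle (d : nat) (y x z : cube d) :
  (hamming x z <= hamming x y + hamming y z)%N.
Proof.
rewrite /hamming; apply: leq_trans (leq_card_setU _ _).
apply/subset_leq_card/fintype.subsetP => i.
by rewrite !inE; case: (x i); case: (y i); case: (z i).
Qed.

(** The ratio of the two binomials is the product of [(n - i) / (d - i)] over [i < h], and each
    factor is at most [n / d]. *)
Lemma bin_sub_mul_expn (d n h : nat) : (h <= n)%N -> (n <= d)%N ->
  ('C(d - h, n - h) * d ^ h <= n ^ h * 'C(d, n))%N.
Proof.
move=> le_hn le_nd; elim: h le_hn => [|h IH] lt_hn.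
  by rewrite !subn0 !expn0 mul1n muln1.
have {IH} := IH (ltnW lt_hn).
have := mul_bin_diag (d - h) (n - h.+1).
have -> : ((n - h.+1).+1 = n - h)%N by lia.
have -> : ((d - h).-1 = d - h.+1)%N by lia.
set a := 'C(_, _); set b := 'C(_, _) => ab IH.
have step : (a * d <= n * b)%N.
  rewrite -(@leq_pmul2l (d - h)); last by lia.
  rewrite mulnA ab mulnAC [X in (_ <= X)%N]mulnA leq_mul2r; apply/orP; right.
  rewrite [X in (_ <= X)%N]mulnC mulnBr mulnBl.
  by rewrite leq_sub2l // [(h * d)%N]mulnC leq_mul2r le_nd orbT.
rewrite !expnS mulnA (leq_trans (leq_mul step (leqnn _))) //.
by rewrite -!mulnA leq_mul2l IH orbT.
Qed.

(** Removing [W] sends these sets injectively to subsets of the complement of [W] with [n - #|W|]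
    elements. *)
Lemma card_draws_supset (T : finType) (W : {set T}) (n : nat) :
  (#|[set Y : {set T} | (W \subset Y) && (#|Y| == n)]|
     <= 'C(#|T| - #|W|, n - #|W|))%N.
Proof.
have -> : (#|T| - #|W| = #|~: W|)%N by rewrite [RHS]cardsCs finset.setCK.
rewrite -(cards_draws (~: W)).
rewrite -(@card_in_imset _ _ (fun Y : {set T} => Y :\: W)); last first.
  move=> Y Y'; rewrite !inE => /andP[sWY _] /andP[sWY' _] eqD.
  by rewrite -(finset.setID Y W) -(finset.setID Y' W) eqD !(finset.setIidPr _).
apply/subset_leq_card/fintype.subsetP => _ /imsetP[Y + ->].
rewrite !inE => /andP[sWY /eqP <-].
by rewrite finset.subsetDr cardsD (finset.setIidPr sWY) eqxx.
Qed.

(* The points y counted here differ from x on at least h of the coordinates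
   where z does, so they are covered by the choices of such an h-subset. *)
Lemma card_sphere_ball (d h n : nat) (x z : cube d) : n.+1 = h.*2 ->
  (#|[set y : cube d | (hamming x y == n) && (hamming y z < h)]|
     <= 8 ^ h * 'C(d - h, n - h))%N.
Proof.
move=> n_h; set B := [set y | _].
pose D := diffset d x.
have D_inj : injective D := diffset_inj d x.
have [->|[y0 y0B]] := set_0Vmem B; first by rewrite cards0.
(* A single counted point [y0] gives [|x - z| <= n + (h - 1) = 3h - 2]; hence [D z] has at most
   [2 ^ (3h) = 8 ^ h] subsets [W]. *)
have cardDz : (#|D z| <= 3 * h)%N.
  move: y0B; rewrite inE => /andP[/eqP xy0 y0z].
  have := hamming_triangle d y0 x z; rewrite xy0 -/(hamming x z) => H.
  by change (hamming x z <= 3 * h)%N; lia.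
pose F (W : {set 'I_d}) := [set Y : {set 'I_d} | (W \subset Y) && (#|Y| == n)].
pose K := [set W : {set 'I_d} | W \subset D z & #|W| == h].
have sub : D @: B \subset \bigcup_(W in K) F W.
  apply/fintype.subsetP => _ /imsetP[y + ->]; rewrite inE => /andP[/eqP xy yz].
  (* Coordinates in [D y] but not in [D z] separate [y] from [z], so there are at most [h - 1] of
     them, and [n - (h - 1) = h]. *)
  have cardI : (h <= #|D y :&: D z|)%N.
    have := cardsID (D z) (D y); rewrite -[X in _ = X]/(hamming x y) xy.
    have : (#|D y :\: D z| <= hamming y z)%N.
      apply/subset_leq_card/fintype.subsetP => i.
      by rewrite !inE; case: (x i); case: (y i); case: (z i).
    by lia.
  have [W /andP[sW /eqP cW]] : exists W : {set 'I_d},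
      (W \subset D y :&: D z) && (#|W| == h).
    have : (0 < #|[set W : {set 'I_d} | W \subset D y :&: D z & #|W| == h]|)%N.
      by rewrite cards_draws bin_gt0.
    by case/card_gt0P => W; rewrite inE => HW; exists W.
  move: sW; rewrite finset.subsetI => /andP[sWy sWz].
  apply/bigcupP; exists W; first by rewrite inE sWz cW eqxx.
  by rewrite inE sWy; apply/eqP.
rewrite -(card_imset _ D_inj); apply: leq_trans (subset_leq_card sub) _.
apply: (@leq_trans (\sum_(W in K) #|F W|)%N).
  elim/big_rec2: _ => [|W m S _ IH]; first by rewrite cards0.
  by apply: leq_trans (leq_card_setU _ _) _; rewrite leq_add2l.
apply: (@leq_trans (\sum_(W in K) 'C(d - h, n - h))%N).
  apply: leq_sum => W; rewrite inE => /andP[_ /eqP cW].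
  by have := card_draws_supset _ W n; rewrite card_ord cW.
rewrite sum_nat_const leq_mul2r; apply/orP; right.
apply: (@leq_trans #|powerset (D z)|).
  by apply/subset_leq_card/fintype.subsetP => W; rewrite !inE => /andP[].
by rewrite card_powerset -[8%N]/(2 ^ 3)%N -expnM leq_exp2l.
Qed.

Lemma card_sphere (d n : nat) (x : cube d) :
  #|[set y : cube d | hamming x y == n]| = 'C(d, n).
Proof.
pose D := diffset d x.
have D_inj : injective D := diffset_inj d x.
rewrite -[d in RHS]card_ord -card_draws -(card_imset _ D_inj).
apply: eq_card => Y.
apply/imsetP/idP => [[y + ->]|]; first by rewrite !inE.
rewrite inE => cY; have DY : Y = D [ffun i => x i (+) (i \in Y)].
  by apply/finset.setP => i; rewrite !inE ffunE; case: (x i); case: (i \in Y).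
exists [ffun i => x i (+) (i \in Y)] => //; rewrite inE.
by change (#|D [ffun i => x i (+) (i \in Y)]| == n); rewrite -DY.
Qed.

Lemma card_sphere_hit (d h n : nat) (x : cube d) (s : seq (cube d)) :
  n.+1 = h.*2 ->
  (#|[set y : cube d | (hamming x y == n) && has (fun z => hamming y z < h)%N s]|
     <= size s * (8 ^ h * 'C(d - h, n - h)))%N.
Proof.
move=> n_h; elim: s => [|z s IH] /=.
  by rewrite mul0n leqn0 cards_eq0; apply/eqP/finset.setP => y; rewrite !inE andbF.
rewrite mulSn (leq_trans _ (leq_add (card_sphere_ball d h n x z n_h) IH)) //.
apply: leq_trans (leq_card_setU _ _); apply/subset_leq_card/fintype.subsetP => y.
by rewrite !inE andb_orr.
Qed.

(** * Finding one seed that is good for many pairs *)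

Lemma probability_setI_ge (dm : measure_display) (T : measurableType dm)
    (K : realType) (P : probability T K) (A B : set T) (a b : K) :
  measurable A -> measurable B -> (a%:E <= P A)%E -> (b%:E <= P B)%E ->
  ((a + b - 1)%:E <= P (A `&` B)%classic)%E.
Proof.
move=> mA mB aA bB.
have mI := measurableI _ _ mA mB; have mU := measurableU _ _ mA mB.
have PU1 := probability_le1 P mU.
have : (P (A `|` B) = P A + P B - P (A `&` B))%classic%E.
  exact: measureUfinl (le_lt_trans (probability_le1 P mA) (ltry 1)).
move: PU1 aA bB.
rewrite -(fineK (fin_num_measure P _ mA)) -(fineK (fin_num_measure P _ mB)).
rewrite -(fineK (fin_num_measure P _ mI)) -(fineK (fin_num_measure P _ mU)).
rewrite -EFinN -!EFinD !lee_fin => U1 aA bB [UE]; move: U1; rewrite UE; lra.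
Qed.

(** First moment method: the expected number of events [E i], [i] in [D], that occur is at least
    [a * #|D|], so some outcome reaches this average. *)
Lemma exists_many_events (dm : measure_display) (T : measurableType dm)
    (P : probability T R) (I : finType) (D : {set I}) (E : I -> set T) (a : R) :
  0 <= a -> (forall i, measurable (E i)) -> (forall i, (a%:E <= P (E i))%E) ->
  exists t, a * #|D|%:R <= #|[set i in D | `[< E i t >]]|%:R.
Proof.
move=> a0 mE aE; apply: contrapT => /forallNP few.
have {}few t : #|[set i in D | `[< E i t >]]|%:R < a * #|D|%:R.
  by rewrite ltNge; apply/negP/few.
(* Counts take finitely many values, so the strict bound is uniform in t. *)
pose m : nat := \max_(k < #|D|.+1 | (k%:R < a * #|D|%:R)) k.
have few_m t : (#|[set i in D | `[< E i t >]]| <= m)%N.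
  have lt : (#|[set i in D | `[< E i t >]]| < #|D|.+1)%N.
    by rewrite ltnS; apply/subset_leq_card/fintype.subsetP => i; rewrite inE => /andP[].
  by apply: (@leq_bigmax_cond _ _ (fun k => nat_of_ord k) (Ordinal lt)); apply: few.
have m_lt : m%:R < a * #|D|%:R.
  (* An outcome exists because [P] has mass 1; its strict bound yields [0 < a * #|D|], which handles
     the neutral element of the maximum. *)
  have [t _] : nonempty [set: T].
    apply/set0P/negP => /eqP T0; have := probability_setT P.
    by rewrite T0 measure0 => /eqP; rewrite eqe eq_sym oner_eq0.
  rewrite /m; elim/big_ind: _ => [|x y|//].
    by apply: le_lt_trans (few t); rewrite ler0n.
  by rewrite /maxn; case: ifP.
have cardE t : (#|[set i in D | `[< E i t >]]|%:R)%:E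
    = (\sum_(i <- enum D) (\1_(E i) t)%:E)%E :> \bar R.
  rewrite -sum1_card natr_sum sumEFin big_enum /=.
  rewrite (eq_bigl (fun i => (i \in D) && `[< E i t >])); last by move=> i; rewrite !inE.
  rewrite big_mkcondr; congr EFin; apply: eq_bigr => i _.
  rewrite indicE; case: asboolP => Et; first by rewrite mem_set.
  by rewrite memNset.
have mind i : measurable_fun [set: T] (fun t => (\1_(E i) t)%:E : \bar R).
  by apply/measurable_EFinP; exact: measurable_indic.
have ind0 i t : (0 <= (\1_(E i) t)%:E :> \bar R)%E by rewrite lee_fin indicE.
(* The integral of the count is at least [a * #|D|] by linearity and at most [m] because the total
   mass is 1. *)
have : ((a * #|D|%:R)%:E <= m%:R%:E :> \bar R)%E.
  apply: (@le_trans _ _ (\int[P]_(t in setT) \sum_(i <- enum D) (\1_(E i) t)%:E)%E).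
    rewrite ge0_integral_sum //.
    rewrite mulr_natr -sumr_const -sumEFin -big_enum /=.
    under [X in (_ <= X)%E]eq_bigr do rewrite integral_indic // setIT.
    by apply: lee_sum => i _; exact: aE.
  apply: (@le_trans _ _ (\int[P]_(t in setT) (functions.cst m%:R%:E t))%E).
    apply: ge0_le_integral => //=.
    - by move=> t _; apply: sume_ge0.
    - exact: emeasurable_sum.
    - by move=> t _; rewrite -cardE lee_fin ler_nat.
  by rewrite integral_cst // [X in (_ * X)%E](probability_setT P) mule1.
by rewrite lee_fin leNgt m_lt.
Qed.

(** * Counting pairs of centres hit by lookups *)

Lemma card_pairs (T T' : finType) (Q : T -> T' -> bool) :
  #|[set p : T * T' | Q p.1 p.2]| = (\sum_x #|[set y | Q x y]|)%N.
Proof.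
rewrite -sum1_card (eq_bigr (fun x => \sum_(y | Q x y) 1)%N) => [|x _].
  by rewrite pair_big_dep; apply: eq_bigl => -[x y]; rewrite !inE.
by rewrite -sum1_card; apply: eq_bigl => y; rewrite inE.
Qed.

Lemma card_pairs_swap (T T' : finType) (Q : T -> T' -> bool) :
  #|[set p : T * T' | Q p.1 p.2]| = (\sum_y #|[set x | Q x y]|)%N.
Proof.
have swap_inj : injective (fun p : T * T' => (p.2, p.1)).
  by move=> [x y] [x' y'] [-> ->].
rewrite -(card_pairs _ _ (fun y x => Q x y)) -(card_imset _ swap_inj).
apply: eq_card => -[y x]; rewrite inE /=; apply/imsetP/idP => [[[x' y']]|Qxy].
  by rewrite inE /= => Q' [-> ->].
by exists (x, y); rewrite ?inE.
Qed.

Lemma card_cube (d : nat) : #|{: cube d}| = (2 ^ d)%N.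
Proof. by rewrite card_ffun card_bool card_ord. Qed.

(** [V p.1] does not depend on [p.2], nor [V' p.2] on [p.1]. Each kind of hit is therefore counted
    with the centre that determines the lookups fixed and the other one varying over a sphere. *)
Lemma card_pairs_hit (d h n L : nat) (V V' : cube d -> seq (cube d)) :
  n.+1 = h.*2 ->
  (forall x, size (V x) <= L)%N -> (forall x, size (V' x) <= L)%N ->
  (#|[set p : cube d * cube d | (hamming p.1 p.2 == n) &&
       (has (fun z => hamming p.2 z < h)%N (V p.1) ||
        has (fun z => hamming p.1 z < h)%N (V' p.2))]|
     <= 2 * (2 ^ d * (L * (8 ^ h * 'C(d - h, n - h)))))%N.
Proof.
move=> n_h sV sV'; set M := (8 ^ h * _)%N.
pose hit1 (x y : cube d) :=
  (hamming x y == n) && has (fun z => hamming y z < h)%N (V x).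
pose hit2 (x y : cube d) :=
  (hamming x y == n) && has (fun z => hamming x z < h)%N (V' y).
have sub : [set p : cube d * cube d | (hamming p.1 p.2 == n) &&
       (has (fun z => hamming p.2 z < h)%N (V p.1) ||
        has (fun z => hamming p.1 z < h)%N (V' p.2))]
    \subset [set p | hit1 p.1 p.2] :|: [set p | hit2 p.1 p.2].
  by apply/fintype.subsetP => p; rewrite !inE andb_orr.
apply: leq_trans (subset_leq_card sub) _; apply: leq_trans (leq_card_setU _ _) _.
rewrite mul2n -addnn card_pairs card_pairs_swap -card_cube -sum_nat_const.
apply: leq_add; apply: leq_sum => x _.
  apply: leq_trans (card_sphere_hit d h n x (V x) n_h) _.
  by rewrite leq_mul2r sV orbT.
under eq_finset => y do rewrite /hit2 hammingC.
apply: leq_trans (card_sphere_hit d h n x (V' x) n_h) _.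
by rewrite leq_mul2r sV' orbT.
Qed.

(** * The hard functions *)

(** The cut at [h] makes valley and peak both equal to [h] at distance at least [h] from their
    centres. So the glued function agrees with the valley off the ball around [y] and with the peak
    off the ball around [x]. *)
Definition valley (d h : nat) (x z : cube d) : R := (minn (hamming x z) h)%:R.
Definition peak (d h : nat) (y z : cube d) : R := h.*2%:R - valley d h y z.
Definition valley_peak (d h : nat) (x y z : cube d) : R :=
  if (hamming y z < h)%N then peak d h y z else valley d h x z.

Lemma valley_lipschitz (d h : nat) (x : cube d) : lipschitz (valley d h x).
Proof.
move=> y z; rewrite /valley ler_distl.
have H1 := hamming_triangle d z x y; have H2 := hamming_triangle d y x z.
rewrite (hammingC _ z y) in H1.
by rewrite lerBlDr -!natrD !ler_nat; lia.
Qed.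

Lemma peak_lipschitz (d h : nat) (y : cube d) : lipschitz (peak d h y).
Proof.
move=> x z; rewrite hammingC (le_trans _ (valley_lipschitz d h y z x)) //.
by rewrite /peak opprB addrC subrKA.
Qed.

Lemma valley_ranged (d h : nat) (x : cube d) : ranged h.*2%:R (valley d h x).
Proof. by move=> z; rewrite /valley ler0n ler_nat; lia. Qed.

Lemma peak_ranged (d h : nat) (y : cube d) : ranged h.*2%:R (peak d h y).
Proof.
move=> z; have /andP[v0 v1] := valley_ranged d h y z.
by rewrite /peak subr_ge0 v1 gerBl.
Qed.

Lemma valley_peak_ranged (d h : nat) (x y : cube d) :
  ranged h.*2%:R (valley_peak d h x y).
Proof.
move=> z; rewrite /valley_peak.
by case: ifP => _; [exact: peak_ranged | exact: valley_ranged].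
Qed.

Lemma valley_peak_eq_valley (d h : nat) (x y z : cube d) :
  (h <= hamming y z)%N -> valley d h x z = valley_peak d h x y z.
Proof. by rewrite /valley_peak leqNgt => /negbTE ->. Qed.

Lemma valley_peak_eq_peak (d h : nat) (x y z : cube d) :
  (h <= hamming x z)%N -> peak d h y z = valley_peak d h x y z.
Proof.
rewrite /valley_peak /peak /valley; case: ltnP => // _ /minn_idPr ->.
by rewrite -addnn natrD addrK.
Qed.

(** If both runs miss, they cannot tell the glued function from the valley, respectively the peak,
    and still answer [0] at [x] and [h.*2] at [y]. These points are only [h.*2 - 1] apart, against
    the Lipschitz property of the output. *)
Lemma good_seed_hits (d h n : nat) (x y : cube d) (t : cube d -> qtree (cube d)) :
  n.+1 = h.*2 -> hamming x y = n ->
  lipschitz (fun z => run (valley_peak d h x y) (t z)) ->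
  (fun z => run (valley d h x) (t z)) = valley d h x ->
  (fun z => run (peak d h y) (t z)) = peak d h y ->
  has (fun z => hamming y z < h)%N (visited (valley d h x) (t x)) ||
  has (fun z => hamming x z < h)%N (visited (peak d h y) (t y)).
Proof.
move=> n_h xy lip fx fy; apply: contraT.
rewrite negb_or => /andP[/hasPn far1 /hasPn far2].
have rx : run (valley_peak d h x y) (t x) = 0.
  rewrite -(@eq_run _ (valley d h x)); last first.
    by move=> z /far1; rewrite -leqNgt => /valley_peak_eq_valley.
  by have := congr1 (fun g => g x) fx; rewrite /= /valley hammingxx min0n.
have ry : run (valley_peak d h x y) (t y) = h.*2%:R.
  rewrite -(@eq_run _ (peak d h y)); last first.
    by move=> z /far2; rewrite -leqNgt => /valley_peak_eq_peak.
  by have := congr1 (fun g => g y) fy; rewrite /= /peak /valley hammingxx min0n subr0.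
have := lip x y; rewrite rx ry sub0r normrN normr_nat xy ler_nat -n_h.
by rewrite ltnn.
Qed.

(** * The lower bound on lookups *)

Lemma filter_lookups_ge (d h L : nat) (dm : measure_display)
    (Omega : measurableType dm) (P : probability Omega R)
    (A : cube d -> Omega -> qtree (cube d)) :
  (0 < h)%N -> (h.*2 <= d)%N ->
  local_lipschitz_filter h.*2%:R P A ->
  (forall f x rho, ranged h.*2%:R f -> lookups f (A x rho) <= L)%N ->
  (d ^ h <= 8 * L * (8 * h.*2) ^ h)%N.
Proof.
move=> h_gt0 le_hd filt bound; pose n := h.*2.-1.
have n_h : n.+1 = h.*2 by rewrite /n; lia.
pose good (p : cube d * cube d) rho :=
  [/\ lipschitz (fun z => run (valley_peak d h p.1 p.2) (A z rho)),
      (fun z => run (valley d h p.1) (A z rho)) = valley d h p.1 &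
      (fun z => run (peak d h p.2) (A z rho)) = peak d h p.2].
have /choice[E HE] (p : cube d * cube d) : exists S : set Omega,
    [/\ measurable S, ((4^-1)%:E <= P S)%E & forall rho, S rho -> good p rho].
  have [S1 [m1 P1 H1]] := filt _ (valley_peak_ranged d h p.1 p.2).
  have [S2 [m2 P2 H2]] := filt _ (valley_ranged d h p.1).
  have [S3 [m3 P3 H3]] := filt _ (peak_ranged d h p.2).
  exists (S1 `&` S2 `&` S3)%classic; split.
  - by apply: measurableI => //; apply: measurableI.
  (* Intersecting three events of probability [3/4] leaves first [1/2], then [1/4]. *)
  - have := probability_setI_ge _ _ _ _ _ _ _ _ (measurableI _ _ m1 m2) m3
      (probability_setI_ge _ _ _ _ _ _ _ _ m1 m2 P1 P2) P3.
    by apply: le_trans; rewrite lee_fin; lra.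
  - move=> rho [[/H1[lip _] /H2[_ eq2]] /H3[_ eq3]]; split => //.
      by apply: eq2; exact: valley_lipschitz.
    by apply: eq3; exact: peak_lipschitz.
pose D := [set p : cube d * cube d | hamming p.1 p.2 == n].
have [rho many] : exists rho,
    4^-1 * #|D|%:R <= #|[set p in D | `[< E p rho >]]|%:R :> R.
  apply: (exists_many_events _ _ P).
  - by rewrite invr_ge0.
  - by move=> p; have [] := HE p.
  - by move=> p; have [] := HE p.
have {}many : (#|D| <= 4 * #|[set p in D | `[< E p rho >]]|)%N.
  by rewrite -(ler_nat R) natrM -ler_pdivrMl.
have cardD : #|D| = (2 ^ d * 'C(d, n))%N.
  rewrite /D (card_pairs _ _ (fun x y => hamming x y == n)).
  by under eq_bigr do rewrite card_sphere; rewrite sum_nat_const card_cube.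
pose V x := visited (valley d h x) (A x rho).
pose V' y := visited (peak d h y) (A y rho).
have sV x : (size (V x) <= L)%N.
  by rewrite size_visited; apply: bound; exact: valley_ranged.
have sV' y : (size (V' y) <= L)%N.
  by rewrite size_visited; apply: bound; exact: peak_ranged.
have few := card_pairs_hit d h n L V V' n_h sV sV'.
have {few} : (#|[set p in D | `[< E p rho >]]|
    <= 2 * (2 ^ d * (L * (8 ^ h * 'C(d - h, n - h)))))%N.
  apply: leq_trans few; apply/subset_leq_card/fintype.subsetP => p.
  rewrite !inE => /andP[/eqP xy /asboolP Ep]; rewrite xy eqxx /=.
  have [_ _ /(_ _ Ep)[lip eq2 eq3]] := HE p.
  exact: (good_seed_hits d h n p.1 p.2 (A^~ rho)).
(* The factor 8 is 4, from the quarter of good pairs, times 2, from the two kinds of hit. *)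
move=> few; have {many few} : ('C(d, n) <= 8 * L * 8 ^ h * 'C(d - h, n - h))%N.
  have p2 : (0 < 2 ^ d)%N by rewrite expn_gt0.
  rewrite -(leq_pmul2l p2) -cardD; apply: leq_trans many _.
  apply: leq_trans (leq_mul (leqnn 4) few) _; apply: eq_leq; ring.
have C_gt0 : (0 < 'C(d, n))%N by rewrite bin_gt0; lia.
have binb : ('C(d - h, n - h) * d ^ h <= n ^ h * 'C(d, n))%N.
  by apply: bin_sub_mul_expn; lia.
move=> Cle; rewrite -(leq_pmul2l C_gt0).
apply: leq_trans (leq_mul Cle (leqnn (d ^ h))) _; rewrite -mulnA.
apply: leq_trans (leq_mul (leqnn _) binb) _.
have nh : (n ^ h <= h.*2 ^ h)%N by rewrite leq_exp2r //; lia.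
apply: leq_trans (leq_mul (leqnn _) (leq_mul nh (leqnn _))) _.
by rewrite expnMn; apply: eq_leq; ring.
Qed.

Theorem theorem4p1 :
  exists c : R, 0 < c /\
  forall (r d : nat), ~~ odd r -> (4 <= r)%N -> (2 ^ 16 * r <= d)%N ->
  forall (dm : measure_display) (Omega : measurableType dm)
         (P : probability Omega R) (A : cube d -> Omega -> qtree (cube d)),
    local_lipschitz_filter (r%:R) P A ->
    exists f : cube d -> R, ranged (r%:R) f /\
      exists (x : cube d) (rho : Omega),
        ((d%:R / r%:R) `^ (c * r%:R) <= (lookups f (A x rho))%:R).
Proof.
(* With [r = 2h] and [s] the square root of [d / r], the target [(d / r) ^ (r / 4)] is [s ^ h]. Then
   [d / r = s ^ 2] leaves a spare factor [s ^ h] to beat the constants. *)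
exists 4^-1; split; first by rewrite invr_gt0.
move=> r d r_even r_ge4 le_rd dm Omega P A filt; apply: contrapT => none.
pose h := r./2; have r_h : r = h.*2 by rewrite /h; lia.
have h_ge2 : (2 <= h)%N by rewrite /h; lia.
pose q : R := d%:R / r%:R; pose s : R := Num.sqrt q.
have r_gt0 : 0 < r%:R :> R by rewrite ltr0n; lia.
have q_ge : 256 ^+ 2 <= q.
  rewrite ler_pdivlMr // -natrX -natrM ler_nat.
  by move: le_rd; rewrite -[(2 ^ 16)%N]/(256 ^ 2)%N.
have q_ge0 : 0 <= q by rewrite (le_trans _ q_ge) // exprn_ge0.
have s_ge : 256 <= s.
  by have := ler_wsqrtr q_ge; rewrite sqrtr_sqr normr_nat.
have ss : s ^+ 2 = q by rewrite sqr_sqrtr.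
have T_E : q `^ (4^-1 * r%:R) = s ^+ h.
  have -> : 4^-1 * r%:R = 2^-1 * h%:R :> R by rewrite r_h -addnn natrD; field.
  by rewrite powRrM powR12_sqrt // powR_mulrn // sqrtr_ge0.
have T_ge0 : 0 <= s ^+ h by rewrite exprn_ge0 // sqrtr_ge0.
(* If the theorem fails, every lookup count is an integer below [s ^ h], hence at most its integer
   part. *)
pose L := Num.truncn (s ^+ h).
have bound f x rho : ranged h.*2%:R f -> (lookups f (A x rho) <= L)%N.
  move=> rf; rewrite truncn_ge_nat // leNgt; apply/negP => lt.
  apply: none; exists f; split; first by rewrite r_h.
  by exists x, rho; rewrite T_E ltW.
have := filter_lookups_ge d h L dm Omega P A _ _ _ bound.
rewrite -r_h => /(_ (ltnW h_ge2) _ filt) H.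
have {H} : (d ^ h <= 8 * L * (8 * r) ^ h)%N by apply: H; lia.
have L_le : L%:R <= s ^+ h by rewrite truncn_le.
rewrite -(ler_nat R) !natrM !natrX natrM.
have -> : d%:R = q * r%:R :> R by rewrite /q mulfVK // gt_eqF.
clear none T_E; clearbody q.
(* Cancelling [r ^ h] leaves [(s ^ h) ^ 2 <= 8 * L * 8 ^ h]. *)
rewrite !exprMn mulrA ler_pM2r ?exprn_gt0 // -ss -exprM mulnC exprM expr2 => le1.
have s_gt0 : 0 < s ^+ h by rewrite exprn_gt0 // (lt_le_trans _ s_ge).
have : s ^+ h * s ^+ h <= s ^+ h * (8 * 8 ^+ h).
  by apply: le_trans le1 _; rewrite mulrAC mulrC ler_pM2r.
rewrite ler_pM2l //; apply/negP; rewrite -ltNge.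
(* The hypothesis [2 ^ 16 * r <= d] gives [s >= 256 = 32 * 8], and [32 ^ h >= 32 > 8]. *)
apply: (@lt_le_trans _ _ (256 ^+ h)); last first.
  by rewrite lerXn2r ?nnegrE // (le_trans _ s_ge).
have -> : 256 = 32 * 8 :> R by rewrite -natrM.
rewrite exprMn ltr_pM2r ?exprn_gt0 //.
by apply: (@lt_le_trans _ _ 32); rewrite ?ltr_nat // ler_eXnr // ?ler1n //; lia.
Qed.
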